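(* There exists $\epsilon>0$ such that for every positive integer $n$, every $4$-AP-intersecting family $\mathcal{A}$ of subsets of $[n]$ satisfies $\mu(\mathcal{A})\le\frac12-\epsilon$.
   Context: $[n]=\{1,\dots,n\}$. For a family $\mathcal{A}$ of subsets of $[n]$, $\mu(\mathcal{A})=|\mathcal{A}|/2^n$. A $4$-AP is an arithmetic progression $\{a,a+d,a+2d,a+3d\}$ of four distinct integers ($d\neq 0$). A family $\mathcal{A}$ is $4$-AP-intersecting if for all $A,B\in\mathcal{A}$ (including the case $A=B$) the set $A\cap B$ contains a $4$-AP. *)

(* Defs.v *)
From mathcomp Require Import all_boot all_order all_algebra.
From mathcomp Require Import reals.

Set Implicit Arguments.
Unset Strict Implicit.
Unset Printing Implicit Defensive.

Import Order.TTheory GRing.Theory Num.Theory.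

Local Open Scope ring_scope.

(* The ground set [n] = {1, ..., n} is represented by 'I_n = {0, ..., n - 1},
   the ordinal i standing for the integer i + 1. *)
Definition label (n : nat) (i : 'I_n) : int := i.+1%:Z.

Definition contains_4AP (n : nat) (S : {set 'I_n}) : Prop :=
  exists a d : int, d != 0 /\
    forall k : 'I_4, exists2 i : 'I_n, i \in S & label i = a + k%:Z * d.

Definition four_AP_intersecting (n : nat) (F : {set {set 'I_n}}) : Prop :=
  forall A B : {set 'I_n}, A \in F -> B \in F -> contains_4AP (A :&: B).

Definition mu (R : realType) (n : nat) (F : {set {set 'I_n}}) : R :=
  #|F|%:R / 2 ^+ n.

(* Main.v *)
(* Draw the bits of a set y one after the other, giving bit i the bias
   1/2 + D_i/4 towards 1, where D_i is the i-th increment of the Doob martingale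
   of the indicator of F.  With T = E [sum D_i^2], y lies in F with probability
   mu F + T/2, and T >= 2/3 * mu F * (1 - mu F).  Given y, flip bit i
   independently with a probability w_i <= |D_i|/2 that undoes the bias, so that
   the result x is uniform.  If both y and the complement of x are in F then
   their intersection has a 4-AP and consists of flipped bits.  Since two terms
   determine a 4-AP, given y the flipped bits contain one with probability at
   most min(1, (sum w_i^2)^2) <= sum w_i^2.  Hence
   2 * mu F + T/2 <= 1 + T/4, which keeps mu F away from 1/2. *)
Require Import Defs.
From mathcomp Require Import all_boot all_order all_algebra.
From mathcomp Require Import reals.
From mathcomp Require Import ring lra zify.

Import Order.TTheory GRing.Theory Num.Theory.

Local Open Scope ring_scope.

(** * Uniform, tilted and flip laws on bit sequences *)

Section TiltedMeasure.
Context {R : realFieldType}.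
Implicit Types (f : pred (seq bool)) (g h : seq bool -> R) (ws : seq R).

(** All laws are built by peeling off the first bit, so a martingale argument becomes an induction
    on [n] with [f] restricted to a half cube. *)
Fixpoint cube_mean (n : nat) (g : seq bool -> R) : R :=
  if n is m.+1 then
    (cube_mean m (fun s => g (true :: s)) +
     cube_mean m (fun s => g (false :: s))) / 2
  else g [::].

Definition density (n : nat) f : R := cube_mean n (fun s => (f s)%:R).

Definition increment (n : nat) f : R :=
  (density n (fun s => f (true :: s)) - density n (fun s => f (false :: s))) / 2.

(** With a bias of c times the increment, the tilt gains 2c T and the flips cost at most 4c^2 T; c =
    1/4 maximizes 2c - 4c^2. *)
Definition tilt (n : nat) f (b : bool) : R :=
  1 / 2 + (if b then increment n f else - increment n f) / 4.

Fixpoint tilted_mean (n : nat) (f : pred (seq bool)) (g : seq bool -> R) : R :=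
  if n is m.+1 then
    tilt m f true *
      tilted_mean m (fun s => f (true :: s)) (fun s => g (true :: s)) +
    tilt m f false *
      tilted_mean m (fun s => f (false :: s)) (fun s => g (false :: s))
  else g [::].

(** The quantity T: the quadratic variation of the Doob martingale, averaged under the tilted law
    rather than the uniform one. *)
Fixpoint energy (n : nat) (f : pred (seq bool)) : R :=
  if n is m.+1 then
    increment m f ^+ 2 +
    (tilt m f true * energy m (fun s => f (true :: s)) +
     tilt m f false * energy m (fun s => f (false :: s)))
  else 0.

(** For the likelier value, of probability q, this solves q (1 - w) = 1/2; the rarer value is never
    flipped. *)
Definition flip_prob (n : nat) f (b : bool) : R :=
  Num.max 0 (1 - (2 * tilt n f b)^-1).

Fixpoint flip_probs (n : nat) (f : pred (seq bool)) (y : seq bool) : seq R :=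
  match n, y with
  | m.+1, b :: y' => flip_prob m f b :: flip_probs m (fun s => f (b :: s)) y'
  | _, _ => [::]
  end.

Fixpoint bernoulli_mean (ws : seq R) (g : seq bool -> R) : R :=
  if ws is w :: ws' then
    w * bernoulli_mean ws' (fun r => g (true :: r)) +
    (1 - w) * bernoulli_mean ws' (fun r => g (false :: r))
  else g [::].

Definition flip (y r : seq bool) : seq bool :=
  [seq p.1 (+) p.2 | p <- zip y r].

(** * Bounds on densities, tilts and flip probabilities *)

Lemma cube_mean_tuple n g :
  cube_mean n g = (\sum_(t : n.-tuple bool) g t) / 2 ^+ n.
Proof.
elim: n g => [|n IHn] g /=.
  rewrite (big_pred1 [tuple]) => [|t]; first by rewrite expr0 divr1.
  by apply/esym/eqP/val_inj; case: t => -[].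
have -> : \sum_(t : n.+1.-tuple bool) g t =
    \sum_(b : bool) \sum_(t : n.-tuple bool) g (b :: t).
  rewrite pair_big /=.
  rewrite (reindex (fun p : bool * n.-tuple bool => [tuple of p.1 :: p.2])) //.
  exists (fun t : n.+1.-tuple bool => (thead t, [tuple of behead t])) => t _ /=.
    case: t => b t /=; congr (_, _); last by apply: val_inj.
  by apply: val_inj => /=; case/tupleP: t => b t /=; rewrite theadE.
rewrite !IHn big_bool /= exprS invfM; field.
by rewrite expf_neq0 ?pnatr_eq0.
Qed.

Lemma cube_mean_map_negb n g :
  cube_mean n (fun s => g (map negb s)) = cube_mean n g.
Proof.
elim: n g => [|n IHn] g //=.
by rewrite (IHn (fun s => g (false :: s))) (IHn (fun s => g (true :: s))) addrC.
Qed.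

Lemma density_itv n f : 0 <= density n f <= 1.
Proof.
rewrite /density; elim: n f => [|n IHn] f /=; first by case: (f _); rewrite ?lexx ?ler01.
have := IHn (fun s => f (true :: s)); have := IHn (fun s => f (false :: s)).
by move=> /andP[? ?] /andP[? ?]; apply/andP; split; lra.
Qed.

Lemma increment_itv n f : - (1 / 2) <= increment n f <= 1 / 2.
Proof.
rewrite /increment; have := density_itv n (fun s => f (true :: s)).
have := density_itv n (fun s => f (false :: s)).
by move=> /andP[? ?] /andP[? ?]; apply/andP; split; lra.
Qed.

Lemma tilt_gt0 n f b : 0 < tilt n f b.
Proof. by rewrite /tilt; have /andP[? ?] := increment_itv n f; case: b; lra. Qed.

Lemma tiltDtilt n f : tilt n f true + tilt n f false = 1.
Proof. by rewrite /tilt; field. Qed.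

Lemma flip_prob_ge0 n f b : 0 <= flip_prob n f b.
Proof. by rewrite /flip_prob le_max lexx. Qed.

Lemma flip_prob_le1 n f b : flip_prob n f b <= 1.
Proof.
rewrite /flip_prob ge_max ler01 gerBl invr_ge0.
by rewrite mulr_ge0 // ltW // tilt_gt0.
Qed.

Lemma tilt_flip_prob n f b :
  tilt n f b * flip_prob n f b = Num.max 0 (tilt n f b - 1 / 2).
Proof.
have q0 := tilt_gt0 n f b.
rewrite /flip_prob maxr_pMr ?ltW // mulr0; congr Num.max.
by field; rewrite gt_eqF.
Qed.

(* Flipping a bit drawn with bias [tilt] restores a fair bit. *)
Lemma tilt_unflip n f b :
  tilt n f b * (1 - flip_prob n f b) + tilt n f (~~ b) * flip_prob n f (~~ b)
    = 1 / 2.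
Proof.
rewrite mulrBr mulr1 !tilt_flip_prob /tilt.
case: b => /=; rewrite /Num.max.
all: by case: ifP; case: ifP; lra.
Qed.

(** If w > 0 then q w = q - 1/2 with q >= 1/2, so w is at most twice the bias q - 1/2, that is, half
    the absolute increment. *)
Lemma sqr_flip_prob_le n f b : flip_prob n f b ^+ 2 <= increment n f ^+ 2 / 4.
Proof.
have q0 := tilt_gt0 n f b.
have w0 := flip_prob_ge0 n f b.
have := tilt_flip_prob n f b; rewrite /Num.max.
set q := tilt n f b in q0 *; set w := flip_prob n f b in w0 *.
have qD : (2 * (q - 1 / 2)) ^+ 2 = increment n f ^+ 2 / 4.
  by rewrite /q /tilt; case: b {q q0 w w0} => /=; field.
case: ifP => q2 qw; last first.
  have /eqP : q * w = 0 by [].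
  by rewrite mulf_eq0 gt_eqF //= => /eqP ->; rewrite expr0n /= divr_ge0 // sqr_ge0.
rewrite -qD ler_sqr ?nnegrE //; last by lra.
by nra.
Qed.

(** * Averages under the tilted law *)

Lemma tilted_mean_le n f g h :
    (forall y, size y = n -> g y <= h y) ->
  tilted_mean n f g <= tilted_mean n f h.
Proof.
elim: n f g h => [|n IHn] f g h gh /=; first exact: gh.
by apply: lerD; rewrite ler_pM2l ?tilt_gt0 //; apply: IHn => y ny;
  apply: gh; rewrite /= ny.
Qed.

Lemma tilted_meanD n f g h :
  tilted_mean n f (fun y => g y + h y) = tilted_mean n f g + tilted_mean n f h.
Proof. by elim: n f g h => [|n IHn] f g h //=; rewrite !IHn; ring. Qed.

Lemma tilted_meanZ n f (a : R) g :
  tilted_mean n f (fun y => a * g y) = a * tilted_mean n f g.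
Proof. by elim: n f g => [|n IHn] f g //=; rewrite !IHn; ring. Qed.

Lemma tilted_mean_cst n f (a : R) : tilted_mean n f (fun=> a) = a.
Proof. by elim: n f => [|n IHn] f //=; rewrite !IHn -mulrDl tiltDtilt mul1r. Qed.

(** Tilting one bit by D/4 towards the denser half, where the halves differ in density by 2D, gains
    D^2/2. *)
Lemma tilted_mean_self n f :
  tilted_mean n f (fun s => (f s)%:R) = density n f + energy n f / 2.
Proof.
elim: n f => [|n IHn] f /=; first by rewrite mul0r addr0.
have dE : density n.+1 f = (density n (fun s => f (true :: s)) +
  density n (fun s => f (false :: s))) / 2 by [].
by rewrite (IHn (fun s => f (true :: s))) (IHn (fun s => f (false :: s))) dE
  /tilt /increment; field.
Qed.

(* The variance of the indicator of [f] is spread over the increments; the tilt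
   changes the total by a bounded factor only. *)
Lemma variance_le_energy n f :
  density n f * (1 - density n f) <= 3 / 2 * energy n f.
Proof.
elim: n f => [|n IHn] f /=.
  by rewrite /density /=; case: (f _); rewrite /= ?subrr ?mulr0 ?mul0r.
have dE : density n.+1 f = (density n (fun s => f (true :: s)) +
  density n (fun s => f (false :: s))) / 2 by [].
have := IHn (fun s => f (true :: s)); have := IHn (fun s => f (false :: s)).
rewrite -(ler_pM2l (tilt_gt0 n f false)) => H0.
rewrite -(ler_pM2l (tilt_gt0 n f true)) => H1.
have /andP[a0 a1] := density_itv n (fun s => f (true :: s)).
have /andP[b0 b1] := density_itv n (fun s => f (false :: s)).
move: H0 H1; rewrite dE /tilt /increment.
move: (density n _) (density n _) a0 a1 b0 b1 => a b a0 a1 b0 b1.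
move: (energy n _) (energy n _) => s t H0 H1.
(* With D = (a - b)/2, the variance of [f] exceeds the tilted average of the variances of its halves
   by D^2 (1 + a + b)/2. As a + b <= 2, this is at most 3/2 D^2, whence the constant 3/2. *)
have : 0 <= (a - b) ^+ 2 * (2 - a - b) by rewrite mulr_ge0 ?sqr_ge0 //; lra.
by lra.
Qed.

(** Whatever the first bit and its flip, the rest of the flipped sequence is uniform by induction;
    the first bit is then fair by [tilt_unflip]. *)
Lemma tilted_mean_flip n f g :
  tilted_mean n f
    (fun y => bernoulli_mean (flip_probs n f y) (fun r => g (flip y r)))
  = cube_mean n g.
Proof.
elim: n f g => [|n IHn] f g //=.
rewrite !tilted_meanD !tilted_meanZ.
have E (b c : bool) : tilted_mean n (fun s => f (b :: s)) (fun y =>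
    bernoulli_mean (flip_probs n (fun s => f (b :: s)) y)
      (fun r => g (flip (b :: y) (c :: r)))) =
    cube_mean n (fun s => g (b (+) c :: s)).
  exact: (IHn (fun s => f (b :: s)) (fun s => g (b (+) c :: s))).
rewrite !E /=.
have := tilt_unflip n f true; have := tilt_unflip n f false => /=.
move: (cube_mean n (fun s => g (true :: s))) (cube_mean n _) => u v H0 H1.
rewrite [RHS](_ : _ = 1 / 2 * u + 1 / 2 * v); last by field.
by rewrite -{1}H1 -H0; ring.
Qed.

Lemma size_flip_probs n f y : size y = n -> size (flip_probs n f y) = n.
Proof. by elim: n f y => [|n IHn] f [|b y] //= [ny]; rewrite IHn. Qed.

Definition prob (w : R) := (0 <= w) && (w <= 1).

Lemma all_prob_flip_probs n f y : all prob (flip_probs n f y).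
Proof.
elim: n f y => [|n IHn] f [|b y] //=.
by rewrite IHn /prob flip_prob_ge0 flip_prob_le1.
Qed.

Lemma tilted_mean_flip_probs n f :
  tilted_mean n f (fun y => \sum_(w <- flip_probs n f y) w ^+ 2)
  <= energy n f / 4.
Proof.
elim: n f => [|n IHn] f /=; first by rewrite big_nil mul0r.
have step b : tilt n f b * tilted_mean n (fun s => f (b :: s)) (fun y =>
      \sum_(w <- flip_prob n f b :: flip_probs n (fun s => f (b :: s)) y) w ^+ 2)
    <= tilt n f b *
       (increment n f ^+ 2 / 4 + energy n (fun s => f (b :: s)) / 4).
  rewrite ler_pM2l ?tilt_gt0 //.
  apply: le_trans (_ : _ <= tilted_mean n (fun s => f (b :: s)) (fun y =>
    increment n f ^+ 2 / 4 +
    \sum_(w <- flip_probs n (fun s => f (b :: s)) y) w ^+ 2)) _.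
    by apply: tilted_mean_le => y _; rewrite big_cons lerD2r sqr_flip_prob_le.
  by rewrite tilted_meanD tilted_mean_cst lerD2l.
apply: le_trans (lerD (step true) (step false)) _.
have -> : tilt n f true = 1 - tilt n f false by rewrite -(tiltDtilt n f) addrK.
by lra.
Qed.

(** * Independent flips with given probabilities *)

Lemma bernoulli_mean_le ws g h : all prob ws ->
    (forall r, size r = size ws -> g r <= h r) ->
  bernoulli_mean ws g <= bernoulli_mean ws h.
Proof.
elim: ws g h => [|w ws IHws] g h /=; first by move=> _; apply.
move=> /andP[/andP[w0 w1] pws] gh.
apply: lerD; apply: ler_wpM2l; rewrite ?subr_ge0 //;
  by apply: IHws => // r nr; apply: gh; rewrite /= nr.
Qed.

Lemma bernoulli_meanD ws g h :
  bernoulli_mean ws (fun r => g r + h r) =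
  bernoulli_mean ws g + bernoulli_mean ws h.
Proof. by elim: ws g h => [|w ws IHws] g h //=; rewrite !IHws; ring. Qed.

Lemma bernoulli_mean_cst ws (a : R) : bernoulli_mean ws (fun=> a) = a.
Proof. by elim: ws => [|w ws IHws] //=; rewrite !IHws; ring. Qed.

Lemma bernoulli_mean_sum (I : Type) (s : seq I) (P : pred I) ws
    (G : I -> seq bool -> R) :
  bernoulli_mean ws (fun r => \sum_(i <- s | P i) G i r) =
  \sum_(i <- s | P i) bernoulli_mean ws (G i).
Proof.
elim: ws G => [|w ws IHws] G //=.
by rewrite !IHws !mulr_sumr -big_split.
Qed.

Lemma bernoulli_meanZ ws (a : R) g :
  bernoulli_mean ws (fun r => a * g r) = a * bernoulli_mean ws g.
Proof. by elim: ws g => [|w ws IHws] g //=; rewrite !IHws; ring. Qed.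

Lemma eq_bernoulli_mean ws g h :
  g =1 h -> bernoulli_mean ws g = bernoulli_mean ws h.
Proof.
elim: ws g h => [|w ws IHws] g h gh //=.
by congr (_ * _ + _ * _); apply: IHws => r.
Qed.

(** Writing the event as a product over all positions lets the induction split off the factor of the
    first one. *)
Lemma bernoulli_mean_all_in ws (A : pred nat) :
  bernoulli_mean ws (fun r => \prod_(i < size ws) (A i ==> nth false r i)%:R) =
  \prod_(i < size ws) (if A i then nth 0 ws i else 1).
Proof.
elim: ws A => [|w ws IHws] A /=; first by rewrite !big_ord0.
have E b : bernoulli_mean ws (fun r => \prod_(i < (size ws).+1)
      (A i ==> nth false (b :: r) i)%:R) =
    (A 0%N ==> b)%:R *
    \prod_(i < size ws) (if A i.+1 then nth 0 ws i else 1).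
  rewrite -(IHws (fun i => A i.+1)) -bernoulli_meanZ.
  by apply: eq_bernoulli_mean => r; rewrite big_ord_recl.
rewrite !E big_ord_recl /=.
by case: (A 0%N) => /=; ring.
Qed.

(** Independence; [uniq I] prevents a repeated index from contributing its weight twice. *)
Lemma bernoulli_mean_all_le ws (I : seq nat) : all prob ws -> uniq I ->
  bernoulli_mean ws (fun r => (all (nth false r) I)%:R)
  <= \prod_(i <- I) nth 0 ws i.
Proof.
move=> pws uI.
have [Iws|/allPn[j jI jws]] := boolP (all (fun i => i < size ws)%N I); last first.
  (* An index past the end reads the default [false], so the event never occurs. *)
  apply: le_trans (_ : bernoulli_mean ws (fun=> 0) <= _).
    apply: bernoulli_mean_le => // r nr.
    case: allP => // /(_ j jI); rewrite nth_default // nr leqNgt //.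
  rewrite bernoulli_mean_cst prodr_ge0 // => i _.
  have [iws|iws] := ltnP i (size ws); last by rewrite nth_default.
  by have /andP[] := allP pws _ (mem_nth 0 iws).
have -> : \prod_(i <- I) nth 0 ws i =
    \prod_(i < size ws) (if (i : nat) \in I then nth 0 ws i else 1).
  rewrite -big_mkcond -(big_mkord (fun i => i \in I) (fun i => nth 0 ws i)).
  rewrite -[RHS]big_filter.
  apply: perm_big; apply: uniq_perm => //; first by rewrite filter_uniq ?iota_uniq.
  move=> i; rewrite mem_filter mem_index_iota /=.
  by have [/(allP Iws) ->|//] := boolP (i \in I).
rewrite -(bernoulli_mean_all_in ws (fun i => i \in I)); apply: bernoulli_mean_le => // r nr.
case: allP => [rI|_]; last by rewrite prodr_ge0.
rewrite big1 // => i _.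
by have [/rI ->|//] := boolP ((i : nat) \in I).
Qed.

(** * Probability that the flips contain a 4-AP *)

(** Each unit shift drops a nonnegative first term and brings in a term past the support. *)
Lemma sum_shift_le (n k : nat) (u : nat -> R) :
    (forall i, 0 <= u i) -> (forall i, (n <= i)%N -> u i = 0) ->
  \sum_(i < n) u (i + k)%N <= \sum_(i < n) u i.
Proof.
move=> u0 un; elim: k => [|k IHk]; first by under eq_bigr do rewrite addn0.
apply: le_trans IHk; case: n un => [|n] un; first by rewrite !big_ord0.
rewrite big_ord_recr [leRHS]big_ord_recl /= un ?addr0; last by lia.
rewrite ler_wpDl //; apply: ler_sum => i _.
by suff -> : (bump 0 i + k = i + k.+1)%N by []; rewrite /bump /=; lia.
Qed.

(* Two of the four terms, in given positions, determine the progression. *)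
Lemma sum_4AP_le (n : nat) (w : nat -> R) :
    (forall i, (n <= i)%N -> w i = 0) ->
  \sum_(a < n) \sum_(d < n) w a * w (a + d)%N * w (a + d * 2)%N * w (a + d * 3)%N
  <= (\sum_(i < n) w i ^+ 2) ^+ 2.
Proof.
move=> wn; set S := \sum_(i < n) w i ^+ 2.
have w2n i : (n <= i)%N -> w i ^+ 2 = 0 by move=> /wn ->; rewrite expr0n.
pose P := \sum_(d < n) \sum_(a < n) w a ^+ 2 * w (a + d)%N ^+ 2.
have PS : P <= S ^+ 2.
  rewrite /P exchange_big /= expr2 {1}/S mulr_suml; apply: ler_sum => a _.
  rewrite -mulr_sumr ler_wpM2l ?sqr_ge0 //.
  under eq_bigr do rewrite addnC.
  by apply: (@sum_shift_le n a (fun i => w i ^+ 2)) => // i; rewrite sqr_ge0.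
pose P' := \sum_(d < n) \sum_(a < n)
  w (a + d * 2)%N ^+ 2 * w (a + d * 3)%N ^+ 2.
have P'P : P' <= P.
  (* For fixed d, the last two terms of a progression are the first two shifted by 2d. *)
  apply: ler_sum => d _.
  pose u i := w i ^+ 2 * w (i + d)%N ^+ 2.
  rewrite (eq_bigr (fun a : 'I_n => u (a + d * 2)%N)) => [|a _]; last first.
    by rewrite /u; congr (_ * w _ ^+ 2); lia.
  apply: (@sum_shift_le n (d * 2) u) => i; first by rewrite mulr_ge0 ?sqr_ge0.
  by move=> ni; rewrite /u w2n ?mul0r.
apply: le_trans PS; rewrite exchange_big /=.
(* AM-GM on each summand, pairing the first two weights against the last two. *)
apply: le_trans (_ : (P + P') / 2 <= _); last by lra.
rewrite /P /P' -big_split mulr_suml; apply: ler_sum => d _.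
rewrite -big_split mulr_suml; apply: ler_sum => a _ /=.
move: (w a) (w (a + d)%N) (w (a + d * 2)%N) (w (a + d * 3)%N) => p q s t.
have := sqr_ge0 (p * q - s * t); lra.
Qed.

(** A decreasing progression can be reversed, so d > 0 suffices; positions past the end of [r] read
    [false], so no range condition is stated. *)
Definition has_4AP (n : nat) (r : seq bool) : bool :=
  [exists a : 'I_n, exists d : 'I_n, (0 < d)%N &&
    all (nth false r) [:: a : nat; (a + d)%N; (a + d * 2)%N; (a + d * 3)%N]].

(** The bound is kept linear in the sum of squares so that it can be averaged over y and compared
    with [energy]. *)
Lemma bernoulli_mean_has_4AP ws : all prob ws ->
  bernoulli_mean ws (fun r => (has_4AP (size ws) r)%:R) <= \sum_(w <- ws) w ^+ 2.
Proof.
move=> pws; set n := size ws; set S := \sum_(w <- ws) _.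
have SE : S = \sum_(i < n) nth 0 ws i ^+ 2 by rewrite /S (big_nth 0) big_mkord.
have S0 : 0 <= S by rewrite SE sumr_ge0 // => i _; rewrite sqr_ge0.
have [S1|/ltW S1] := leP 1 S.
  apply: le_trans S1.
  apply: le_trans (_ : bernoulli_mean ws (fun=> 1) <= _); last by rewrite bernoulli_mean_cst.
  by apply: bernoulli_mean_le => // r _; rewrite lern1 leq_b1.
apply: le_trans (_ : S ^+ 2 <= _); last by rewrite expr2 ler_piMl.
have w0 i : 0 <= nth 0 ws i.
  have [iws|iws] := ltnP i n; last by rewrite nth_default.
  by have /andP[] := allP pws _ (mem_nth 0 iws).
rewrite SE; apply: le_trans (sum_4AP_le n (nth 0 ws) _); last first.
  by move=> i ni; rewrite nth_default.
pose ap (a d : nat) := [:: a; (a + d)%N; (a + d * 2)%N; (a + d * 3)%N].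
(* Union bound over the progressions. *)
apply: le_trans (_ : bernoulli_mean ws (fun r => \sum_(a < n) \sum_(d < n | (0 < d)%N)
  (all (nth false r) (ap a d))%:R) <= _).
  apply: bernoulli_mean_le => // r _.
  have sum0 (a : 'I_n) : 0 <= \sum_(d < n | (0 < d)%N)
      (all (nth false r) (ap a d))%:R :> R by rewrite sumr_ge0.
  rewrite /has_4AP; case: existsP => [[a /existsP[d /andP[d0 rad]]]|_]; last first.
    exact: sumr_ge0.
  have {}rad : all (nth false r) (ap a d) by [].
  rewrite (bigD1 a) // ler_wpDr //; first exact: sumr_ge0.
  by rewrite (bigD1 d) // rad ler_wpDr // sumr_ge0.
rewrite bernoulli_mean_sum; apply: ler_sum => a _.
rewrite bernoulli_mean_sum big_mkcond; apply: ler_sum => d _.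
(* The bounding sum also has terms with d = 0, which are nonnegative; for d > 0 the four positions
   are distinct. *)
case: ifP => d0; last by rewrite !mulr_ge0.
apply: le_trans (bernoulli_mean_all_le _ _ pws _) _.
  by rewrite /ap /= !inE; lia.
by rewrite /ap !big_cons big_nil mulr1 !mulrA.
Qed.

(** * The density bound *)

(** Where [y] has a 1, the complement of [flip y r] carries the bit of [r]. *)
Lemma nth_meet_negb_flip y r i : size y = size r ->
    nth false [seq p.1 && p.2 | p <- zip y (map negb (flip y r))] i ->
  nth false r i.
Proof.
rewrite /flip; elim: y r i => [|b y IHy] [|c r] [|i] //=; first by case: b; case: c.
by move=> [yr]; apply: IHy.
Qed.

Lemma density_4AP_intersecting n f :
    (forall s t, size s = n -> size t = n -> f s -> f t ->
       has_4AP n [seq p.1 && p.2 | p <- zip s t]) ->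
  density n f <= 1 / 2 - 1 / 100.
Proof.
move=> fI.
pose g s : R := (f (map negb s))%:R.
have gE : cube_mean n g = density n f by exact: (cube_mean_map_negb n (fun s => (f s)%:R)).
(* The left side is the probability of [f y] plus that of [f] at the complement of [flip y r]; the
   two indicators are compared pointwise with 1 plus that of a 4-AP in [r]. *)
have key : density n f + energy n f / 2 + density n f <= 1 + energy n f / 4.
  rewrite -tilted_mean_self -gE -(tilted_mean_flip n f g) -tilted_meanD.
  apply: le_trans (_ : _ <= tilted_mean n f (fun y =>
    1 + \sum_(w <- flip_probs n f y) w ^+ 2)) _; last first.
    by rewrite tilted_meanD tilted_mean_cst lerD2l tilted_mean_flip_probs.
  apply: tilted_mean_le => y ny.
  set ws := flip_probs n f y.
  have nws : size ws = n by rewrite size_flip_probs.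
  have pws : all prob ws by exact: all_prob_flip_probs.
  rewrite -(bernoulli_mean_cst ws (f y)%:R) -bernoulli_meanD.
  apply: le_trans (_ : _ <= bernoulli_mean ws (fun r =>
    1 + (has_4AP n r)%:R)) _; last first.
    rewrite bernoulli_meanD bernoulli_mean_cst lerD2l -{1}nws.
    exact: bernoulli_mean_has_4AP.
  apply: bernoulli_mean_le => // r nr; rewrite {}nws in nr.
  rewrite /g; case fy : (f y) => /=; last first.
    by rewrite add0r ler_wpDr // lern1 leq_b1.
  rewrite lerD2l ler_nat.
  case fx : (f _) => //=; suff -> : has_4AP n r by [].
  have := fI _ _ ny _ fy fx; rewrite size_map /flip size_map size_zip ny nr minnn.
  move=> /(_ erefl) /existsP[a /existsP[d /andP[d0 apr]]].
  apply/existsP; exists a; apply/existsP; exists d; rewrite d0 /=.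
  by apply: sub_all apr => i; apply: nth_meet_negb_flip; rewrite ny nr.
(* Eliminating the energy gives m^2 - 13 m + 6 >= 0 for the density m in [0, 1], so m <= (13 - sqrt
   145)/2 < 0.48; the constant 1/100 leaves room. *)
have := variance_le_energy n f; have /andP[m0 m1] := density_itv n f.
move: (density n f) (energy n f) key m0 m1 => m t; nra.
Qed.

End TiltedMeasure.

(** * Transfer from bit sequences to families of sets *)

Definition set_of_seq (n : nat) (s : seq bool) : {set 'I_n} :=
  [set i : 'I_n | nth false s i].

Lemma mu_density (R : realType) (n : nat) (F : {set {set 'I_n}}) :
  mu R F = density n (fun s => set_of_seq n s \in F).
Proof.
rewrite /mu /density cube_mean_tuple; congr (_ / _).
rewrite -sum1_card natr_sum big_mkcond.
rewrite (reindex (fun t : n.-tuple bool => set_of_seq n t)) /=.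
  by apply: eq_bigr => t _; case: (_ \in F).
exists (fun A : {set 'I_n} => [tuple i \in A | i < n]) => x _.
  apply: eq_from_tnth => i; rewrite tnth_mktuple inE.
  by rewrite (tnth_nth false).
by apply/setP => i; rewrite inE -(tnth_nth false _ i) tnth_mktuple.
Qed.

Lemma contains_4AP_has_4AP (n : nat) (r : seq bool) :
  contains_4AP (set_of_seq n r) -> has_4AP n r.
Proof.
move=> [a [d [d0 ap]]].
have [i0] := ap (@Ordinal 4 0 isT); have [i1] := ap (@Ordinal 4 1 isT).
have [i2] := ap (@Ordinal 4 2 isT); have [i3] := ap (@Ordinal 4 3 isT).
rewrite !inE /label /= => r3 e3 r2 e2 r1 e1 r0 e0.
have dn : (`|d| < n)%N by have := ltn_ord i0; have := ltn_ord i1; lia.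
have d_gt0 : (0 < `|d|)%N by lia.
apply/existsP; have [dpos|dneg] := leP 0 d.
  exists i0; apply/existsP; exists (Ordinal dn) => /=; rewrite d_gt0 r0.
  have -> : (i0 + `|d| = i1)%N by lia.
  have -> : (i0 + `|d| * 2 = i2)%N by lia.
  have -> : (i0 + `|d| * 3 = i3)%N by lia.
  by rewrite r1 r2 r3.
(* A negative difference is read backwards from the last term. *)
exists i3; apply/existsP; exists (Ordinal dn) => /=; rewrite d_gt0 r3.
have -> : (i3 + `|d| = i2)%N by lia.
have -> : (i3 + `|d| * 2 = i1)%N by lia.
have -> : (i3 + `|d| * 3 = i0)%N by lia.
by rewrite r0 r1 r2.
Qed.

Theorem theorem3p3 (R : realType) :
  exists2 eps : R, 0 < eps &
    forall (n : nat) (F : {set {set 'I_n}}),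
      (0 < n)%N -> four_AP_intersecting F -> mu R F <= 1 / 2 - eps.
Proof.
exists (1 / 100); first by lra.
move=> n F _ FI; rewrite mu_density; apply: density_4AP_intersecting.
move=> s t ns nt sF tF; apply: contains_4AP_has_4AP.
suff -> : set_of_seq n [seq p.1 && p.2 | p <- zip s t] =
    set_of_seq n s :&: set_of_seq n t by exact: FI.
apply/setP => i; rewrite !inE (nth_map (false, false)) ?nth_zip ?ns ?nt //.
by rewrite size_zip ns nt minnn.
Qed.
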